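(* Suppose that (a) $f:\mathbb{R}^n\to\mathbb{R}$ is twice continuously differentiable and $\sigma_f$-weakly convex (i.e. $f(x)+(\sigma_f/2)\|x\|^2$ is convex), $\nabla f$ is Lipschitz continuous with modulus $\ell_f$, and $\nabla^2 f$ is Lipschitz continuous with modulus $L_f$; (b) $A\in\mathbb{R}^{m\times n}$ has full row rank, with $\gamma>0$ defined by $\gamma^2:=\lambda_{\min}(AA^\top)$; (c) $f$ is coercive, i.e. $f(x)\to\infty$ as $\|x\|\to\infty$; and (d) the parameters satisfy $\mu>\sigma_f$ and $$c_3:=\frac{\mu+\ell_f+c_1}{\gamma},\quad c_4:=\frac{\mu+c_1}{\gamma},\quad \rho>\max\left\{\frac{8(c_3^2+c_4^2)}{\mu},\frac{4\ell_f}{\gamma^2}\right\},\quad \beta:=\frac{4c_4^2}{\rho}.$$ Let $\{(x^k,u^k,y^k)\}$ be the sequence generated by iNALM. Then any accumulation point $(x^*,u^*,y^* )$ of this sequence is a P-stationary triplet of the problem (P): $\min_{x,u} f(x)+\lambda h(u)$ subject to $Ax+b=u$.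
   Context: $[m]=\{1,\dots,m\}$; for $T\subseteq[m]$, $\overline T:=[m]\setminus T$ and $v_T$ is the subvector of $v$ indexed by $T$. $h(u):=\|u_+\|_0$ is the number of strictly positive entries of $u$. Data: $\lambda,\mu>0$, $b\in\mathbb{R}^m$. P-stationary triplet of (P): a triple $(x,u,y)$ for which there exists $\alpha>0$ with $\nabla f(x)+A^\top y=0$, $u\in\mathrm{Prox}_{\alpha\lambda h(\cdot)}(u+\alpha y)$ and $Ax+b-u=0$, where $\mathrm{Prox}_{\alpha\lambda h(\cdot)}(v):=\arg\min_{z}\{\alpha\lambda h(z)+\frac12\|z-v\|^2\}$ (set-valued). Define $$\mathcal L_\rho(x,u,y):=f(x)+\langle y,Ax+b-u\rangle+\tfrac\rho2\|Ax+b-u\|^2+\lambda h(u),\qquad \mathcal V_{\rho,\theta}(x,u,y,v):=\mathcal L_\rho(x,u,y)+\tfrac\theta2\|x-v\|^2,$$ $$g_k(x,u):=f(x)+\langle y^k,Ax+b-u\rangle+\tfrac\rho2\|Ax+b-u\|^2+\tfrac\mu2\|x-x^k\|^2 .$$ $\overline\ell_g>0$ is a Lipschitz modulus of $\nabla g_k$ valid for all $k$; $\sigma_g:=\mu-\sigma_f$. GSNewton applied to a function $g$ (with $G:=g+\lambda h$), with $\alpha\in(0,1/\overline\ell_g)$, $t\in(0,2/\overline\ell_g)$ and starting point $\zeta^0$: for $j=0,1,\dots$, with $\zeta^j=(x^j,u^j)$, $y^j:=-\nabla_ug(\zeta^j)$: (1) $\Gamma_j:=\{i\in[m]:[u^j+\alpha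 y^j]_i\in[0,\sqrt{2\alpha\lambda})\}$; (2) $u^{j+1/2}_i:=0$ for $i\in\Gamma_j$, $u^{j+1/2}_i:=[u^j+\alpha y^j]_i$ for $i\notin\Gamma_j$, $x^{j+1/2}:=x^j-t\nabla_xg(x^j,u^{j+1/2})$, $\zeta^{j+1/2}:=(x^{j+1/2},u^{j+1/2})$; (3) $\widetilde\zeta^{j+1}=(x,u)$ solves $u_{\Gamma_j}=0$ and $H^{j+1/2}[x-x^{j+1/2};(u-u^{j+1/2})_{\overline\Gamma_j}]=-[\nabla_xg(\zeta^{j+1/2});(\nabla_ug(\zeta^{j+1/2}))_{\overline\Gamma_j}]$, where $H^{j+1/2}$ is the Hessian of $g$ at $\zeta^{j+1/2}$ in the variables $(x,u_{\overline\Gamma_j})$; (4) $\zeta^{j+1}:=\widetilde\zeta^{j+1}$ if $G(\zeta^{j+1/2})-G(\widetilde\zeta^{j+1})\ge(\sigma_g/4)\|\widetilde\zeta^{j+1}-\zeta^{j+1/2}\|^2$, and $\zeta^{j+1}:=\zeta^{j+1/2}$ otherwise. Residuals: with $\Gamma:=\{i\in[m]:[u-\alpha\nabla_ug_k(x,u)]_i\in[0,\sqrt{2\alpha\lambda})\}$, $\mathcal R_1(x,u):=\|\nabla_xg_k(x,u)\|$, $\mathcal R_2(x,u):=\|[u_\Gamma;\ \alpha(\nabla_ug_k(x,u))_{\overline\Gamma}]\|$, $\mathcal R_3(x,u):=\frac{\alpha^2}2\|\nabla_ug_k(x,u)\|^2+\alpha\lambda\|u_+\|_0-\Phi_{\alpha\lambda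 h(\cdot)}(u-\alpha\nabla_ug_k(x,u))$, where $\Phi_{\alpha\lambda h(\cdot)}(v):=\min_{z}\{\alpha\lambda h(z)+\frac12\|z-v\|^2\}$. Algorithm iNALM: given $\epsilon_k>0$ with $\epsilon_k\to0$, $c_1,c_2>0$ and $(x^0,u^0,y^0)$. At iteration $k=0,1,\dots$: apply GSNewton to $g_k$ from $(x^k,u^k)$, generating $(x^{k,j},u^{k,j})$; stop as soon as an index $j_k$ satisfies $$\mathcal R_1(x^{k,j_k},u^{k,j_k})\le c_1\|x^{k,j_k}-x^k\|,\quad \mathcal R_2(x^{k,j_k},u^{k,j_k})\le c_2\|x^{k,j_k}-x^k\|^2,\quad \mathcal R_3(x^{k,j_k},u^{k,j_k})\le\epsilon_k,$$ and set $(x^{k+1},u^{k+1}):=(x^{k,j_k},u^{k,j_k})$; then $y^{k+1}:=y^k+\rho(Ax^{k+1}+b-u^{k+1})$. If the $x$-part of the limit of the GSNewton sequence equals $x^k$, then $(x^{k+1},u^{k+1})$ is instead taken to be a P-stationary point of $\min g_k+\lambda h$ satisfying these three inequalities (with $(x^{k+1},u^{k+1})$ in place of $(x^{k,j_k},u^{k,j_k})$). In all cases $\mathcal V_{\rho,\mu}(x^{k+1},u^{k+1},y^k,x^k)\le\mathcal V_{\rho,\mu}(x^k,u^k,y^k,x^k)$. *)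

(* Defs.v *)
From HB Require Import structures.
From mathcomp Require Import all_boot all_order all_algebra.
From mathcomp Require Import all_classical all_reals all_analysis.
Export numFieldNormedType.Exports.

Set Implicit Arguments.
Unset Strict Implicit.
Unset Printing Implicit Defensive.
Import Order.TTheory GRing.Theory Num.Theory.
Import numFieldNormedType.Exports.

Local Open Scope classical_set_scope.
Local Open Scope ring_scope.

(* Vectors of R^n are column vectors. The library norm on matrices is the sup
   norm, hence the Euclidean and operator norms below. *)

Definition dotp (R : realType) (n : nat) (v w : 'cV[R]_n) : R :=
  \sum_(i < n) v i 0 * w i 0.

Definition enorm (R : realType) (n : nat) (v : 'cV[R]_n) : R :=
  Num.sqrt (\sum_(i < n) v i 0 ^+ 2).

Definition opnorm (R : realType) (m n : nat) (M : 'M[R]_(m, n)) : R :=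
  sup [set enorm (M *m v) | v in [set v : 'cV[R]_n | enorm v <= 1]].

Definition is_lambda_min (R : realType) (m : nat) (M : 'M[R]_m) (l : R) : Prop :=
  eigenvalue M l /\ forall a : R, eigenvalue M a -> l <= a.

Definition grad (R : realType) (n : nat) (f : 'cV[R]_n -> R) (x : 'cV[R]_n) :
    'cV[R]_n :=
  \col_(i < n) 'D_(delta_mx i 0) f x.

Definition hess (R : realType) (n : nat) (f : 'cV[R]_n -> R) (x : 'cV[R]_n) :
    'M[R]_n :=
  \matrix_(i < n, j < n)
    'D_(delta_mx j 0) (fun z : 'cV[R]_n => grad f z i 0) x.

Definition twice_cont_diff (R : realType) (n : nat) (f : 'cV[R]_n -> R) : Prop :=
  [/\ forall x : 'cV[R]_n, differentiable f x,
      forall x : 'cV[R]_n, differentiable (grad f) x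
    & continuous (hess f)].

Definition grad_lipschitz (R : realType) (n : nat) (l : R)
    (f : 'cV[R]_n -> R) : Prop :=
  forall x y : 'cV[R]_n, enorm (grad f x - grad f y) <= l * enorm (x - y).

Definition hess_lipschitz (R : realType) (n : nat) (l : R)
    (f : 'cV[R]_n -> R) : Prop :=
  forall x y : 'cV[R]_n, opnorm (hess f x - hess f y) <= l * enorm (x - y).

Definition weakly_convex (R : realType) (n : nat) (sigma : R)
    (f : 'cV[R]_n -> R) : Prop :=
  convex_function (E := 'cV[R]_n) setT
    (fun x : 'cV[R]_n => f x + sigma / 2 * enorm x ^+ 2).

Definition coercive (R : realType) (n : nat) (f : 'cV[R]_n -> R) : Prop :=
  forall M : R, exists r : R, forall x : 'cV[R]_n, r <= enorm x -> M <= f x.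

(* h(u), the number of positive entries of u. *)
Definition hpos (R : realType) (m : nat) (u : 'cV[R]_m) : nat :=
  #|[set i : 'I_m | 0 < u i 0]%SET|.

Definition prox_obj (R : realType) (m : nat) (tau : R) (v z : 'cV[R]_m) : R :=
  tau * (hpos z)%:R + 1 / 2 * enorm (z - v) ^+ 2.

Definition prox_h (R : realType) (m : nat) (tau : R) (v : 'cV[R]_m) :
    set 'cV[R]_m :=
  [set z | forall z' : 'cV[R]_m, prox_obj tau v z <= prox_obj tau v z'].

(* The Moreau envelope Phi; the infimum is attained for tau >= 0. *)
Definition envelope_h (R : realType) (m : nat) (tau : R) (v : 'cV[R]_m) : R :=
  inf (range (prox_obj tau v)).

Definition P_stationary_triplet (R : realType) (n m : nat) (lambda : R)
    (f : 'cV[R]_n -> R) (A : 'M[R]_(m, n)) (b : 'cV[R]_m)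
    (x : 'cV[R]_n) (u y : 'cV[R]_m) : Prop :=
  exists alpha : R, [/\ 0 < alpha,
    grad f x + A^T *m y = 0,
    prox_h (alpha * lambda) (u + alpha *: y) u
  & A *m x + b - u = 0].

(* A pair (x, u) is the stacked vector col_mx x u of R^(n + m). *)

Definition gradx (R : realType) (n m : nat) (g : 'cV[R]_(n + m) -> R)
    (z : 'cV[R]_(n + m)) : 'cV[R]_n := usubmx (grad g z).

Definition gradu (R : realType) (n m : nat) (g : 'cV[R]_(n + m) -> R)
    (z : 'cV[R]_(n + m)) : 'cV[R]_m := dsubmx (grad g z).

Definition P_stationary_point (R : realType) (n m : nat) (lambda : R)
    (g : 'cV[R]_(n + m) -> R) (z : 'cV[R]_(n + m)) : Prop :=
  exists alpha : R, [/\ 0 < alpha, gradx g z = 0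
  & prox_h (alpha * lambda) (dsubmx z - alpha *: gradu g z) (dsubmx z)].

Definition subvec (R : realType) (m : nat) (T : {set 'I_m}) (v : 'cV[R]_m) :
    'cV[R]_#|T| :=
  \col_(i < #|T|) v (enum_val i) 0.

(* [x; u_T] for z = (x, u) *)
Definition subvec_xu (R : realType) (n m : nat) (T : {set 'I_m})
    (z : 'cV[R]_(n + m)) : 'cV[R]_(n + #|T|) :=
  col_mx (usubmx z) (subvec T (dsubmx z)).

(* The Hessian of g at z in the variables (x, u_T). *)
Definition hess_xu (R : realType) (n m : nat) (T : {set 'I_m})
    (g : 'cV[R]_(n + m) -> R) (z : 'cV[R]_(n + m)) : 'M[R]_(n + #|T|) :=
  let H := hess g z in
  let e := fun i : 'I_#|T| => enum_val i in
  block_mx (ulsubmx H) (colsub e (ursubmx H))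
           (rowsub e (dlsubmx H)) (mxsub e e (drsubmx H)).

Definition Gamma (R : realType) (n m : nat) (lambda alpha : R)
    (g : 'cV[R]_(n + m) -> R) (z : 'cV[R]_(n + m)) : {set 'I_m} :=
  [set i : 'I_m | 0 <= (dsubmx z - alpha *: gradu g z) i 0
                    < Num.sqrt (2 * alpha * lambda)]%SET.

Definition gsnewton_half (R : realType) (n m : nat) (lambda alpha t : R)
    (g : 'cV[R]_(n + m) -> R) (z : 'cV[R]_(n + m)) : 'cV[R]_(n + m) :=
  let u' : 'cV[R]_m :=
    \col_(i < m) (if i \in Gamma lambda alpha g z then 0
                  else (dsubmx z - alpha *: gradu g z) i 0) in
  col_mx (usubmx z - t *: gradx g (col_mx (usubmx z) u')) u'.

Definition newton_point (R : realType) (n m : nat) (G : {set 'I_m})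
    (g : 'cV[R]_(n + m) -> R) (zh z : 'cV[R]_(n + m)) : Prop :=
  subvec G (dsubmx z) = 0 /\
  hess_xu (~: G)%SET g zh *m subvec_xu (~: G)%SET (z - zh)
    = - subvec_xu (~: G)%SET (grad g zh).

Definition gsnewton (R : realType) (n m : nat) (lambda sigma alpha t : R)
    (g : 'cV[R]_(n + m) -> R) (z0 : 'cV[R]_(n + m))
    (z : nat -> 'cV[R]_(n + m)) : Prop :=
  let G := fun w : 'cV[R]_(n + m) => g w + lambda * (hpos (dsubmx w))%:R in
  z 0%N = z0 /\
  forall j : nat,
    let zh := gsnewton_half lambda alpha t g (z j) in
    exists zt : 'cV[R]_(n + m),
      newton_point (Gamma lambda alpha g (z j)) g zh zt /\
      z j.+1 = (if sigma / 4 * enorm (zt - zh) ^+ 2 <= G zh - G zt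
                then zt else zh).

Definition aug_smooth (R : realType) (n m : nat) (rho : R)
    (f : 'cV[R]_n -> R) (A : 'M[R]_(m, n)) (b : 'cV[R]_m)
    (x : 'cV[R]_n) (u y : 'cV[R]_m) : R :=
  f x + dotp y (A *m x + b - u) + rho / 2 * enorm (A *m x + b - u) ^+ 2.

Definition auglag (R : realType) (n m : nat) (lambda rho : R)
    (f : 'cV[R]_n -> R) (A : 'M[R]_(m, n)) (b : 'cV[R]_m)
    (x : 'cV[R]_n) (u y : 'cV[R]_m) : R :=
  aug_smooth rho f A b x u y + lambda * (hpos u)%:R.

Definition lyapunov (R : realType) (n m : nat) (lambda rho theta : R)
    (f : 'cV[R]_n -> R) (A : 'M[R]_(m, n)) (b : 'cV[R]_m)
    (x : 'cV[R]_n) (u y : 'cV[R]_m) (v : 'cV[R]_n) : R :=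
  auglag lambda rho f A b x u y + theta / 2 * enorm (x - v) ^+ 2.

(* g_k, with (xk, yk) = (x^k, y^k) *)
Definition subpb (R : realType) (n m : nat) (mu rho : R)
    (f : 'cV[R]_n -> R) (A : 'M[R]_(m, n)) (b : 'cV[R]_m)
    (xk : 'cV[R]_n) (yk : 'cV[R]_m) (z : 'cV[R]_(n + m)) : R :=
  aug_smooth rho f A b (usubmx z) (dsubmx z) yk
  + mu / 2 * enorm (usubmx z - xk) ^+ 2.

Definition res1 (R : realType) (n m : nat)
    (g : 'cV[R]_(n + m) -> R) (z : 'cV[R]_(n + m)) : R :=
  enorm (gradx g z).

Definition res2 (R : realType) (n m : nat) (lambda alpha : R)
    (g : 'cV[R]_(n + m) -> R) (z : 'cV[R]_(n + m)) : R :=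
  let G := Gamma lambda alpha g z in
  enorm (col_mx (subvec G (dsubmx z)) (alpha *: subvec (~: G)%SET (gradu g z))).

Definition res3 (R : realType) (n m : nat) (lambda alpha : R)
    (g : 'cV[R]_(n + m) -> R) (z : 'cV[R]_(n + m)) : R :=
  alpha ^+ 2 / 2 * enorm (gradu g z) ^+ 2
  + alpha * lambda * (hpos (dsubmx z))%:R
  - envelope_h (alpha * lambda) (dsubmx z - alpha *: gradu g z).

Definition inexact (R : realType) (n m : nat) (lambda alpha c1 c2 eps : R)
    (g : 'cV[R]_(n + m) -> R) (xk : 'cV[R]_n) (z : 'cV[R]_(n + m)) : Prop :=
  [/\ res1 g z <= c1 * enorm (usubmx z - xk),
      res2 lambda alpha g z <= c2 * enorm (usubmx z - xk) ^+ 2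
    & res3 lambda alpha g z <= eps].

(* znext = (x^(k+1), u^(k+1)) is produced from (x^k, u^k) by the inner solver
   applied to g = g_k. *)
Definition inner_solve (R : realType) (n m : nat)
    (lambda sigma alpha t c1 c2 eps : R)
    (g : 'cV[R]_(n + m) -> R) (xk : 'cV[R]_n) (uk : 'cV[R]_m)
    (znext : 'cV[R]_(n + m)) : Prop :=
  exists z : nat -> 'cV[R]_(n + m),
    let stalls := exists zlim : 'cV[R]_(n + m),
      z j @[j --> \oo] --> zlim /\ usubmx zlim = xk in
    [/\ gsnewton lambda sigma alpha t g (col_mx xk uk) z,
        stalls -> P_stationary_point lambda g znext /\
                  inexact lambda alpha c1 c2 eps g xk znext
      & ~ stalls ->
        exists jk : nat,
          [/\ inexact lambda alpha c1 c2 eps g xk (z jk),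
              forall j : nat, (j < jk)%N ->
                ~ inexact lambda alpha c1 c2 eps g xk (z j)
            & znext = z jk]].

Definition iNALM (R : realType) (n m : nat)
    (lambda mu rho sigma_f alpha t c1 c2 : R) (eps : nat -> R)
    (f : 'cV[R]_n -> R) (A : 'M[R]_(m, n)) (b : 'cV[R]_m)
    (x : nat -> 'cV[R]_n) (u y : nat -> 'cV[R]_m) : Prop :=
  forall k : nat,
    [/\ inner_solve lambda (mu - sigma_f) alpha t c1 c2 (eps k)
          (subpb mu rho f A b (x k) (y k)) (x k) (u k)
          (col_mx (x k.+1) (u k.+1)),
        lyapunov lambda rho mu f A b (x k.+1) (u k.+1) (y k) (x k)
          <= lyapunov lambda rho mu f A b (x k) (u k) (y k) (x k)
      & y k.+1 = y k + rho *: (A *m x k.+1 + b - u k.+1)].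

(* Main.v *)
(* Only the inequalities accepted at the end of each inner solve matter, not how
   GSNewton reached them. Since grad_u g_k at the new iterate is - y^(k+1), the
   bound on R_1 reads
     |grad f(x^(k+1)) + A^T y^(k+1) + mu (x^(k+1) - x^k)| <= c1 |x^(k+1) - x^k|,
   so by gamma |v| <= |A^T v| the multiplier increments satisfy
     |y^(k+1) - y^k| <= c3 |x^(k+1) - x^k| + c4 |x^k - x^(k-1)|.
   The dual ascent term |y^(k+1) - y^k|^2 / rho is thus absorbed by the proximal
   term, and L_rho(x^k, u^k, y^k) + (beta / 2) |x^k - x^(k-1)|^2 decreases by at
   least (mu / 4) |x^(k+1) - x^k|^2. Along a subsequence converging to the
   accumulation point it is bounded below, because h >= 0; being monotone it
   converges, hence x^(k+1) - x^k -> 0 and A x^k + b - u^k -> 0. The bound on R_3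
   says that u^(k+1) is an eps_k-minimizer of the prox objective, which passes to
   the limit by lower semicontinuity of h. *)

Require Import Defs.
From HB Require Import structures.
From mathcomp Require Import all_boot all_order all_algebra.
From mathcomp Require Import all_classical all_reals all_analysis.
From mathcomp Require Import ring lra.
Import Order.TTheory GRing.Theory Num.Theory.
Import numFieldNormedType.Exports.

Local Open Scope classical_set_scope.
Local Open Scope ring_scope.

(** * Euclidean inner product and norm *)

Section EuclideanSpace.
Context {R : realType}.
Set Implicit Arguments.
Unset Strict Implicit.
Implicit Types (n m p : nat).

Lemma dotpE n (v w : 'cV[R]_n) : dotp v w = (v^T *m w) 0 0.
Proof. by rewrite mxE; apply: eq_bigr => i _; rewrite mxE. Qed.

Lemma dotpC n (v w : 'cV[R]_n) : dotp v w = dotp w v.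
Proof. by apply: eq_bigr => i _; rewrite mulrC. Qed.

Lemma dotpDr n (v w1 w2 : 'cV[R]_n) : dotp v (w1 + w2) = dotp v w1 + dotp v w2.
Proof. by rewrite !dotpE mulmxDr mxE. Qed.

Lemma dotpZr n a (v w : 'cV[R]_n) : dotp v (a *: w) = a * dotp v w.
Proof. by rewrite !dotpE -scalemxAr mxE. Qed.

Lemma dotpDl n (v1 v2 w : 'cV[R]_n) : dotp (v1 + v2) w = dotp v1 w + dotp v2 w.
Proof. by rewrite dotpC dotpDr (dotpC w v1) (dotpC w v2). Qed.

Lemma dotpZl n a (v w : 'cV[R]_n) : dotp (a *: v) w = a * dotp v w.
Proof. by rewrite dotpC dotpZr (dotpC w). Qed.

Lemma dotpNr n (v w : 'cV[R]_n) : dotp v (- w) = - dotp v w.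
Proof. by rewrite -scaleN1r dotpZr mulN1r. Qed.

Lemma dotp0r n (v : 'cV[R]_n) : dotp v 0 = 0.
Proof. by rewrite -(scale0r v) dotpZr mul0r. Qed.

Lemma dotp_mulmxr n p (v : 'cV[R]_n) (M : 'M[R]_(n, p)) (w : 'cV[R]_p) :
  dotp v (M *m w) = dotp (M^T *m v) w.
Proof. by rewrite !dotpE trmx_mul trmxK mulmxA. Qed.

Lemma dotp_delta n (v : 'cV[R]_n) i : dotp v (delta_mx i 0) = v i 0.
Proof.
rewrite /dotp (bigD1 i) //= mxE !eqxx mulr1 big1 ?addr0// => j ji.
by rewrite mxE (negbTE ji) mulr0.
Qed.

Lemma dotpvv_ge0 n (v : 'cV[R]_n) : 0 <= dotp v v.
Proof. by apply: sumr_ge0 => i _; rewrite -expr2 sqr_ge0. Qed.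

Lemma dotpvv_eq0 n (v : 'cV[R]_n) : (dotp v v == 0) = (v == 0).
Proof.
apply/idP/eqP => [|->]; last by rewrite dotp0r.
rewrite psumr_eq0 => [/allP v0|i _]; last by rewrite -expr2 sqr_ge0.
apply/colP => i; rewrite mxE; apply/eqP.
by have := v0 i (mem_index_enum i); rewrite /= -expr2 sqrf_eq0.
Qed.

Lemma enormE n (v : 'cV[R]_n) : enorm v = Num.sqrt (dotp v v).
Proof. by congr Num.sqrt; apply: eq_bigr => i _; rewrite expr2. Qed.

Lemma enorm_ge0 n (v : 'cV[R]_n) : 0 <= enorm v.
Proof. by rewrite sqrtr_ge0. Qed.

Lemma enorm_sqr n (v : 'cV[R]_n) : enorm v ^+ 2 = dotp v v.
Proof. by rewrite enormE sqr_sqrtr// dotpvv_ge0. Qed.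

Lemma enorm_eq0 n (v : 'cV[R]_n) : (enorm v == 0) = (v == 0).
Proof. by rewrite -(sqrf_eq0 (enorm v)) enorm_sqr dotpvv_eq0. Qed.

Lemma enormZ n a (v : 'cV[R]_n) : enorm (a *: v) = `|a| * enorm v.
Proof.
by rewrite !enormE dotpZl dotpZr mulrA -expr2 sqrtrM ?sqr_ge0// sqrtr_sqr.
Qed.

Lemma enormN n (v : 'cV[R]_n) : enorm (- v) = enorm v.
Proof. by rewrite -scaleN1r enormZ normrN1 mul1r. Qed.

(** Cauchy-Schwarz: expand the squared norm of [enorm w *: v - enorm v *: w], which is nonnegative,
    and divide by [enorm v * enorm w]; zero vectors are treated apart. *)
Lemma dotp_le_enorm n (v w : 'cV[R]_n) : dotp v w <= enorm v * enorm w.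
Proof.
have [->|v0] := eqVneq v 0; first by rewrite dotpC dotp0r mulr_ge0 ?enorm_ge0.
have nv : 0 < enorm v by rewrite lt_neqAle enorm_ge0 eq_sym enorm_eq0 v0.
have := dotpvv_ge0 (enorm w *: v - enorm v *: w).
rewrite -scaleNr !(dotpDl, dotpDr, dotpZl, dotpZr) (dotpC w v) -!enorm_sqr => h.
have [w0|w0] := eqVneq w 0; first by rewrite w0 dotp0r mulr_ge0 ?enorm_ge0.
have nw : 0 < enorm w by rewrite lt_neqAle enorm_ge0 eq_sym enorm_eq0 w0.
have vw : 0 < enorm v * enorm w by rewrite mulr_gt0.
rewrite -(ler_pM2l vw); nra.
Qed.

Lemma enormD n (v w : 'cV[R]_n) : enorm (v + w) <= enorm v + enorm w.
Proof.
rewrite -ler_sqr ?nnegrE ?addr_ge0 ?enorm_ge0//.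
rewrite sqrrD !enorm_sqr !(dotpDl, dotpDr) (dotpC w v).
by have := dotp_le_enorm v w; lra.
Qed.

End EuclideanSpace.

(** * Limits of matrices, inner products and norms *)

Section Convergence.
Context {R : realType} {T : Type} {F : set_system T} {FF : Filter F}.
Set Implicit Arguments.
Unset Strict Implicit.
Implicit Types (n m p : nat).

Lemma cvg_mxP n m (M : T -> 'M[R]_(n, m)) (L : 'M[R]_(n, m)) :
  M @ F --> L <-> forall i j, M k i j @[k --> F] --> L i j.
Proof.
split=> [ML i j|ML].
  exact: (cvg_comp _ _ ML (@coord_continuous _ _ _ i j L)).
apply/cvg_ballP => e e0.
have : \forall k \near F, forall i j, ball (L i j) e (M k i j).
  apply: filter_forall => i; apply: filter_forall => j.
  by move/cvg_ballP: (ML i j); apply.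
by apply: filterS => k Mk; split.
Qed.

Lemma cvg_mulmx n m p (B : 'M[R]_(p, n)) (M : T -> 'M[R]_(n, m)) L :
  M @ F --> L -> B *m M k @[k --> F] --> B *m L.
Proof.
move=> /cvg_mxP ML; apply/cvg_mxP => i j; rewrite mxE.
under eq_cvg do rewrite mxE.
by apply: cvg_big => [|l _]; [exact: add_continuous|]; apply: cvgM => //; exact: cvg_cst.
Qed.

Lemma cvg_dotp n (v w : T -> 'cV[R]_n) a b :
  v @ F --> a -> w @ F --> b -> dotp (v k) (w k) @[k --> F] --> dotp a b.
Proof.
move=> /cvg_mxP va /cvg_mxP wb.
by apply: cvg_big => [|l _]; [exact: add_continuous|]; apply: cvgM.
Qed.

Lemma cvg_enorm n (v : T -> 'cV[R]_n) a :
  v @ F --> a -> enorm (v k) @[k --> F] --> enorm a.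
Proof.
move=> va; rewrite enormE; under eq_cvg do rewrite enormE.
by apply: cvg_comp (cvg_dotp va va) _; exact: sqrt_continuous.
Qed.

End Convergence.

(** * Variational characterization of the least eigenvalue *)

Section Rayleigh.
Context {R : realType} {m : nat}.
Set Implicit Arguments.
Unset Strict Implicit.
Implicit Types (M : 'M[R]_m) (v w : 'cV[R]_m).

(** A continuous quadratic form attains its minimum on the compact unit sphere. The sphere is
    transposed to row vectors to fit [EVT_min_rV]. *)
Lemma rayleigh_attained M : (0 < m)%N ->
  exists2 v, dotp v v = 1 & forall w, dotp w w = 1 ->
    dotp v (M *m v) <= dotp w (M *m w).
Proof.
move=> m0.
pose S := [set r : 'rV[R]_m | dotp r^T r^T = 1].
have cvgT (r : 'rV[R]_m) : (fun s : 'rV[R]_m => s^T) @ r --> r^T.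
  by apply/(@cvg_mxP _ _ (nbhs r)) => i j; rewrite mxE; under eq_cvg do rewrite mxE;
    exact: coord_continuous.
have cont1 : continuous (fun r : 'rV[R]_m => dotp r^T r^T).
  by move=> r; exact: (@cvg_dotp _ _ (nbhs r) _ _ _ _ _ _ (cvgT r) (cvgT r)).
have cont2 : continuous (fun r : 'rV[R]_m => dotp r^T (M *m r^T)).
  move=> r; apply: (@cvg_dotp _ _ (nbhs r)); first exact: cvgT.
  exact: (@cvg_mulmx _ _ (nbhs r) _ _ _ _ M _ _ (cvgT r)).
have S0 : S !=set0.
  exists (delta_mx 0 (Ordinal m0)).
  by rewrite /S /= trmx_delta dotp_delta mxE !eqxx.
have cS : compact S.
  apply: bounded_closed_compact.
    exists 1; split => // a a1 r Sr.
    apply: le_trans (ltW a1); rewrite [leLHS]/Num.norm/= mx_normrE.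
    apply: bigmax_le => // -[i j] _ /=; rewrite (ord1 i).
    rewrite -(@ler_sqr R) ?nnegrE// expr1n -Sr real_normK ?num_real//.
    rewrite /dotp (bigD1 j) //= !mxE -expr2 lerDl sumr_ge0// => l _.
    by rewrite -expr2 sqr_ge0.
  rewrite (_ : S = (fun r : 'rV[R]_m => dotp r^T r^T) @^-1` [set 1])//.
  by apply: closed_comp; [move=> r _; exact: cont1|exact: closed_eq].
have [r rS rmin] := EVT_min_rV S0 cS (continuous_subspaceT cont2).
exists r^T; first by rewrite inE in rS.
by move=> w w1; have := rmin w^T; rewrite trmxK inE /S /= trmxK; apply.
Qed.

(** A unit minimizer [w] of the quadratic form is an eigenvector by first-order optimality, so its
    value [r] is an eigenvalue and [l <= r]; homogeneity extends the bound from the sphere to all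
    vectors. *)
Lemma lambda_min_le_dotp M l v : M^T = M -> is_lambda_min M l ->
  l * dotp v v <= dotp v (M *m v).
Proof.
move=> Msym [_ lmin].
have [->|v0] := eqVneq v 0; first by rewrite mulmx0 !dotp0r mulr0.
have m0 : (0 < m)%N.
  by case: {+}m v v0 => // v /eqP[]; apply/colP => -[].
have [w w1 wmin] := rayleigh_attained M m0.
set r := dotp w (M *m w) in wmin.
have rge (z : 'cV[R]_m) : r * dotp z z <= dotp z (M *m z).
  have [->|z0] := eqVneq z 0; first by rewrite mulmx0 !dotp0r mulr0.
  have nz : 0 < enorm z by rewrite lt_neqAle enorm_ge0 eq_sym enorm_eq0 z0.
  have := wmin ((enorm z)^-1 *: z).
  rewrite -scalemxAr !(dotpZl, dotpZr) -enorm_sqr => h.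
  have : r <= (enorm z)^-1 * ((enorm z)^-1 * dotp z (M *m z)).
    by apply: h; field; rewrite gt_eqF.
  by rewrite mulrA -invfM -expr2 mulrC ler_pdivlMr ?exprn_gt0// mulrC.
suff : M *m w = r *: w.
  move=> Mw; apply: le_trans (rge v).
  apply: ler_wpM2r; first exact: dotpvv_ge0.
  apply: lmin; apply/eigenvalueP; exists w^T.
    by rewrite -{1}Msym -trmx_mul Mw linearZ.
  by apply/eqP => /(congr1 trmx); rewrite trmxK trmx0 => w0;
    move: w1; rewrite w0 dotp0r => /eqP; rewrite eq_sym oner_eq0.
have [d dE] : exists d, M *m w = d + r *: w.
  by exists (M *m w - r *: w); rewrite subrK.
(* The form [z |-> dotp z (M *m z) - r * dotp z z] is nonnegative and vanishes
   at [w], so its derivative there in the direction [d] vanishes. *)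
pose q := dotp d (M *m d) - r * dotp d d.
have q0 : 0 <= q by rewrite subr_ge0.
have key s : 0 <= 2 * s * dotp d d + s ^+ 2 * q.
  have := rge (w + s *: d).
  rewrite mulmxDr -scalemxAr !(dotpDl, dotpDr, dotpZl, dotpZr) w1.
  have -> : dotp w (M *m d) = dotp d (M *m w).
    by rewrite dotp_mulmxr Msym dotpC.
  have -> : dotp d (M *m w) = dotp d d + r * dotp d w.
    by rewrite dE dotpDr dotpZr.
  rewrite (dotpC w d) -/r /q; lra.
have dd0 := dotpvv_ge0 d.
suff : dotp d d == 0 by rewrite dotpvv_eq0 dE => /eqP ->; rewrite add0r.
rewrite eq_le dd0 andbT.
(* The step [- D / (1 + q)] stays defined when [q = 0] and turns [key] into
   [0 <= - D ^+ 2 * (2 + q) / (1 + q) ^+ 2], which forces [D = 0]. *)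
have q1 : 0 < 1 + q by lra.
have := key (- (dotp d d / (1 + q))).
set D := dotp d d in dd0 *.
have -> : 2 * - (D / (1 + q)) * D + (- (D / (1 + q))) ^+ 2 * q =
  - (D ^+ 2 * (2 + q) / (1 + q) ^+ 2) by field; rewrite gt_eqF.
rewrite oppr_ge0 pmulr_lle0 ?invr_gt0 ?exprn_gt0// pmulr_lle0; last by lra.
by rewrite real_exprn_even_le0 ?num_real//= => /eqP ->.
Qed.

End Rayleigh.

(** * Gradient of the subproblem objective *)

Section Gradient.
Context {R : realType}.
Set Implicit Arguments.
Unset Strict Implicit.

(** Along the line the difference quotient is exactly [c + h * d]. *)
Lemma is_derive_quadratic (V : normedModType R) (F : V -> R) a v c d :
  (forall h, F (h *: v + a) = F a + h * c + h ^+ 2 * d) -> is_derive a v F c.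
Proof.
move=> Fq.
suff cvgF : h^-1 *: ((F \o shift a) (h *: v) - F a) @[h --> 0^'] --> c.
  by split; [exact: cvgP cvgF|exact: cvg_lim cvgF].
have : c + h * d @[h --> (0 : R)^'] --> c.
  rewrite -[X in _ --> X]addr0 -[X in _ --> _ + X](mul0r d).
  apply: cvgD; first exact: cvg_cst.
  by apply: cvgM; [exact: cvg_within|exact: cvg_cst].
apply: cvg_trans; apply: near_eq_cvg; near=> h.
have h0 : h != 0 by near: h; exact: nbhs_dnbhs_neq.
by rewrite /= Fq /GRing.scale/=; field.
Unshelve. all: by end_near. Qed.

Variables (n m : nat).

Lemma is_derive_usubmx (f : 'cV[R]_n -> R) (z v : 'cV[R]_(n + m)) :
  differentiable f (usubmx z) ->
  is_derive z v (f \o usubmx) ('D_(usubmx v) f (usubmx z)).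
Proof.
move=> df.
have E : (fun h : R => h^-1 *: ((f \o usubmx \o shift z) (h *: v) - (f \o usubmx) z))
    = (fun h : R => h^-1 *: ((f \o shift (usubmx z)) (h *: usubmx v) - f (usubmx z))).
  by apply/funext => h /=; rewrite !linearD !linearZ.
have : derivable f (usubmx z) (usubmx v) by exact: diff_derivable.
by rewrite /derivable -E => dv; split; rewrite // /derive E.
Qed.

Variables (f : 'cV[R]_n -> R) (mu rho : R) (A : 'M[R]_(m, n)) (b : 'cV[R]_m).
Variables (xk : 'cV[R]_n) (yk : 'cV[R]_m).
Hypothesis df : forall x, differentiable f x.

(** The objective is [f \o usubmx] plus a remainder [Q] that is exactly quadratic along every line;
    the multiplier and penalty terms combine into [w]. *)
Lemma derive_subpb (z v : 'cV[R]_(n + m)) :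
  let w := yk + rho *: (A *m usubmx z + b - dsubmx z) in
  'D_v (subpb mu rho f A b xk yk) z =
  'D_(usubmx v) f (usubmx z) + dotp w (A *m usubmx v - dsubmx v)
  + mu * dotp (usubmx z - xk) (usubmx v).
Proof.
move=> w; rewrite -addrA.
pose r z := A *m usubmx z + b - dsubmx z : 'cV[R]_m.
pose Q z := dotp yk (r z) + rho / 2 * enorm (r z) ^+ 2
  + mu / 2 * enorm (usubmx z - xk) ^+ 2.
rewrite (_ : subpb _ _ _ _ _ _ _ = (f \o usubmx) + Q); last first.
  by apply/funext => x; rewrite /subpb /aug_smooth /Q !fctE /= -/(r x) !addrA.
pose s := A *m usubmx v - dsubmx v.
have dQ : is_derive z v Q (dotp w s + mu * dotp (usubmx z - xk) (usubmx v)).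
  apply: (@is_derive_quadratic _ _ _ _ _
    (rho / 2 * dotp s s + mu / 2 * dotp (usubmx v) (usubmx v))) => h.
  have rE : r (h *: v + z) = h *: s + r z.
    rewrite /r /s !linearD !linearZ /=.
    by rewrite -!addrA; congr +%R; rewrite [RHS]addrCA; congr +%R; rewrite addrCA.
  have pE : usubmx (h *: v + z) - xk = h *: usubmx v + (usubmx z - xk).
    by rewrite !linearD !linearZ /= addrA.
  rewrite /Q rE pE /w -/(r z) -/s {rE pE}.
  move: (r z) (s) (usubmx z - xk) (usubmx v) => r' {s}s' p q.
  rewrite !enorm_sqr !(dotpDl, dotpDr, dotpZl, dotpZr).
  by rewrite (dotpC r' s') (dotpC p q); field.
have dfu := @is_derive_usubmx f z v (df _).
exact: (@derive_val _ _ _ _ _ _ _ (is_deriveD dfu dQ)).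
Qed.

(** Here [w] is the multiplier update evaluated at [z]; at the new iterate it is the new multiplier,
    so the inner residuals become conditions on that multiplier. *)
Lemma grad_subpb (z : 'cV[R]_(n + m)) :
  let w := yk + rho *: (A *m usubmx z + b - dsubmx z) in
  grad (subpb mu rho f A b xk yk) z =
  col_mx (grad f (usubmx z) + A^T *m w + mu *: (usubmx z - xk)) (- w).
Proof.
move=> w; apply/colP => i; rewrite mxE derive_subpb -/w.
case: (split_ordP i) => j ->.
  rewrite col_mxEu delta_mx_ushift col_mxKu col_mxKd subr0.
  by rewrite dotp_mulmxr !dotp_delta !mxE.
rewrite col_mxEd delta_mx_dshift col_mxKu col_mxKd mulmx0 sub0r dotpNr dotp_delta.
by rewrite dotp0r mulr0 addr0 derive0 add0r [RHS]mxE.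
Qed.

End Gradient.

(** * Subsequences and sufficient descent *)

Section Sequences.
Context {R : realType}.
Set Implicit Arguments.
Unset Strict Implicit.

(** Pick an index beyond [k] in the ball of radius [1 / (k + 1)]. The map [phi] may fail to be
    monotone; [k < phi k] suffices for passing to limits. *)
Lemma cluster_subseq (T : pseudoMetricType R) (s : nat -> T) (p : T) :
  cluster (s k @[k --> \oo]) p ->
  exists2 phi : nat -> nat, (forall k, (k < phi k)%N) &
    s (phi k) @[k --> \oo] --> p.
Proof.
move=> sp.
have H k : exists j, (k < j)%N /\ ball p k.+1%:R^-1 (s j).
  have Ak : (s k @[k --> \oo]) (s @` [set j | (k < j)%N]).
    by exists k.+1 => // j /= kj; exists j.
  have [_ [[j kj <-] pj]] := sp _ _ Ak (nbhsx_ballx p _ (harmonic_gt0 k)).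
  by exists j.
have [phi phiP] := choice H.
exists phi => [k|]; first by have [] := phiP k.
apply/cvg_ballP => e e0; near=> k.
have [_] := phiP k; apply: le_ball; near: k.
have /cvgr0_norm_le /(_ e e0) := @cvg_harmonic R.
by apply: filterS => k; exact: le_trans (ler_norm _).
Unshelve. all: by end_near. Qed.

Lemma cvg_subseq_ge (T : topologicalType) (s : nat -> T) (p : T) (phi : nat -> nat) :
  (forall k, (k <= phi k)%N) -> s k @[k --> \oo] --> p ->
  s (phi k) @[k --> \oo] --> p.
Proof.
move=> phi_ge sp; apply: cvg_comp sp => A [N _ NA].
by exists N => // k /= Nk; apply: NA => /=; exact: leq_trans (phi_ge k).
Qed.

(** A lower bound at arbitrarily late indices bounds the whole nonincreasing [V], which therefore
    converges; its increments dominate [c * a k ^+ 2]. *)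
Lemma descent_cvg0 (V a : nat -> R) (c B : R) : 0 < c ->
  (forall k, V k.+1 + c * a k ^+ 2 <= V k) ->
  (forall N, exists2 k, (N <= k)%N & B <= V k) ->
  a k @[k --> \oo] --> 0.
Proof.
move=> c0 Vdec Vinf.
have Vni : nonincreasing_seq V.
  apply/nonincreasing_seqP => k; apply: le_trans (Vdec k).
  by rewrite lerDl mulr_ge0 ?sqr_ge0// ltW.
have VB k : B <= V k.
  by have [j kj Bj] := Vinf k; apply: le_trans (Vni _ _ kj).
have /cvg_ex[l Vl] : cvgn V.
  by apply: nonincreasing_is_cvgn => //; exists B => _ [k _ <-].
have Vl1 : V k.+1 @[k --> \oo] --> l by rewrite (cvg_shiftS V).
have d0 : c^-1 * (V k - V k.+1) @[k --> \oo] --> 0.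
  rewrite -(mulr0 c^-1) -(subrr l).
  by apply: cvgM; [exact: cvg_cst|exact: cvgB].
have a20 : a k ^+ 2 @[k --> \oo] --> 0.
  apply: (squeeze_cvgr _ (cvg_cst (0 : R)) d0).
  by apply: nearW => k; rewrite sqr_ge0 /= ler_pdivlMl// lerBrDl.
apply: norm_cvg0; under eq_cvg do rewrite -sqrtr_sqr.
have := @cvg_comp _ _ _ _ Num.sqrt _ _ _ a20 (@sqrt_continuous R 0).
by rewrite sqrtr0.
Qed.

End Sequences.

(** * Stability of the proximal inclusion under limits *)

Section ProxLimit.
Context {R : realType} {m : nat}.
Set Implicit Arguments.
Unset Strict Implicit.

Lemma envelope_h_le (tau : R) (v z : 'cV[R]_m) : 0 <= tau ->
  envelope_h tau v <= prox_obj tau v z.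
Proof.
move=> tau0; apply: ge_inf; last by exists z.
exists 0 => _ [w _ <-]; rewrite /prox_obj.
by apply: addr_ge0; apply: mulr_ge0; rewrite ?sqr_ge0 ?ler0n //; lra.
Qed.

(** Lower semicontinuity of [hpos]: each positive entry of the limit is eventually positive along
    the sequence, and there are finitely many entries. *)
Lemma near_hpos_le (u : nat -> 'cV[R]_m) (us : 'cV[R]_m) :
  u @ \oo --> us -> \forall k \near \oo, (hpos us <= hpos (u k))%N.
Proof.
move=> /cvg_mxP uus.
have : \forall k \near \oo, forall i, 0 < us i 0 -> 0 < u k i 0.
  apply: filter_forall => i; have [ui0|_] := boolP (0 < us i 0); last exact: nearW.
  by apply: filterS (cvgr_gt _ (uus i 0) _ ui0) => k.
apply: filterS => k uk; apply: subset_leq_card; apply/fintype.subsetP => i.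
by rewrite !inE; exact: uk.
Qed.

Lemma prox_h_limit (lambda alpha : R) (u y : nat -> 'cV[R]_m)
    (us ys : 'cV[R]_m) (e : nat -> R) :
  0 <= alpha * lambda -> u @ \oo --> us -> y @ \oo --> ys ->
  e k @[k --> \oo] --> 0 ->
  (forall z k, alpha ^+ 2 / 2 * enorm (y k) ^+ 2 + alpha * lambda * (hpos (u k))%:R
     - prox_obj (alpha * lambda) (u k + alpha *: y k) z <= e k) ->
  prox_h (alpha * lambda) (us + alpha *: ys) us.
Proof.
move=> tau0 uus yys e0 opt z; set tau := alpha * lambda in tau0 opt *.
have vz : u k + alpha *: y k @[k --> \oo] --> us + alpha *: ys.
  by apply: cvgD => //; apply: cvgZr.
rewrite /prox_obj; set h := (hpos us)%:R; set hz := (hpos z)%:R.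
(* The discontinuous [hpos (u k)] is replaced by the constant [h], eventually no larger, so that
   both sides converge. *)
have lhs : tau * h + 1 / 2 * enorm (alpha *: y k) ^+ 2 @[k --> \oo] -->
    tau * h + 1 / 2 * enorm (us - (us + alpha *: ys)) ^+ 2.
  rewrite opprD addrA subrr sub0r enormN !enorm_sqr; under eq_cvg do rewrite enorm_sqr.
  apply: cvgD; first exact: cvg_cst.
  by apply: cvgM; [exact: cvg_cst|apply: cvg_dotp; exact: cvgZr].
have rhs : tau * hz + 1 / 2 * enorm (z - (u k + alpha *: y k)) ^+ 2 + e k @[k --> \oo] -->
    tau * hz + 1 / 2 * enorm (z - (us + alpha *: ys)) ^+ 2.
  rewrite -[X in _ --> X]addr0; apply: cvgD => //.
  rewrite !enorm_sqr; under eq_cvg do rewrite enorm_sqr.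
  apply: cvgD; first exact: cvg_cst.
  by apply: cvgM; [exact: cvg_cst|apply: cvg_dotp; apply: cvgB => //; exact: cvg_cst].
apply: ler_cvg_to lhs rhs _.
apply: filterS (near_hpos_le uus) => k hk.
have := opt z k; rewrite /prox_obj enormZ exprMn real_normK ?num_real// -/hz.
have : tau * h <= tau * (hpos (u k))%:R by rewrite ler_wpM2l// ler_nat.
lra.
Qed.

End ProxLimit.

(** * Estimates for one outer iteration *)

Section Iteration.
Context {R : realType} {n m : nat}.
Set Implicit Arguments.
Unset Strict Implicit.

Lemma inner_solve_inexact (lambda sigma alpha t c1 c2 eps : R)
    (g : 'cV[R]_(n + m) -> R) (xk : 'cV[R]_n) (uk : 'cV[R]_m) z :
  inner_solve lambda sigma alpha t c1 c2 eps g xk uk z ->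
  inexact lambda alpha c1 c2 eps g xk z.
Proof.
move=> [w [_ st nst]].
set stalls := (exists zlim : 'cV[R]_(n + m), _) in st nst.
by have [/st[]//|/nst[j [? _ ->]]] := pselect stalls.
Qed.

(** Only the linear multiplier term changes, by [rho] times the squared constraint residual. *)
Lemma auglag_dual_step (lambda rho : R) (f : 'cV[R]_n -> R) (A : 'M[R]_(m, n)) b x u y y' :
  0 < rho -> y' = y + rho *: (A *m x + b - u) ->
  auglag lambda rho f A b x u y' =
  auglag lambda rho f A b x u y + enorm (y' - y) ^+ 2 / rho.
Proof.
move=> rho0 ->; rewrite /auglag /aug_smooth.
move: (A *m x + b - u) => r; rewrite [X in enorm (X - y)]addrC addrK.
rewrite dotpDl dotpZl !enorm_sqr dotpZl dotpZr; field; lra.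
Qed.

(** The squared norm of [A^T *m v] is the quadratic form of [A *m A^T] at [v]. *)
Lemma enorm_le_trmx (A : 'M[R]_(m, n)) (gamma : R) (v : 'cV[R]_m) :
  0 < gamma -> is_lambda_min (A *m A^T) (gamma ^+ 2) ->
  gamma * enorm v <= enorm (A^T *m v).
Proof.
move=> gamma0 gammaP.
have sym : (A *m A^T)^T = A *m A^T by rewrite trmx_mul trmxK.
rewrite -(@ler_sqr R) ?nnegrE ?mulr_ge0 ?enorm_ge0 ?(ltW gamma0)//.
rewrite exprMn !enorm_sqr; apply: le_trans (lambda_min_le_dotp v sym gammaP) _.
by rewrite -mulmxA dotp_mulmxr.
Qed.

(** Subtracting the two stationarity errors [e1] and [e2] isolates [A^T *m (y2 - y1)]; the triangle
    inequality bounds the remaining terms. *)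
Lemma multiplier_diff_le (f : 'cV[R]_n -> R) (A : 'M[R]_(m, n))
    (gamma l_f mu c1 : R) (x0 x1 x2 : 'cV[R]_n) (y1 y2 : 'cV[R]_m) :
  0 <= mu -> 0 < gamma -> is_lambda_min (A *m A^T) (gamma ^+ 2) ->
  grad_lipschitz l_f f ->
  enorm (grad f x1 + A^T *m y1 + mu *: (x1 - x0)) <= c1 * enorm (x1 - x0) ->
  enorm (grad f x2 + A^T *m y2 + mu *: (x2 - x1)) <= c1 * enorm (x2 - x1) ->
  enorm (y2 - y1) <= (mu + l_f + c1) / gamma * enorm (x2 - x1)
                     + (mu + c1) / gamma * enorm (x1 - x0).
Proof.
move=> mu0 gamma0 gammaP fL.
set e1 := grad f x1 + _ + _; set e2 := grad f x2 + _ + _ => r1 r2.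
rewrite -(ler_pM2l gamma0); apply: le_trans (enorm_le_trmx _ gamma0 gammaP) _.
have -> : A^T *m (y2 - y1) = e2 - e1 - (grad f x2 - grad f x1)
    + (mu *: (x1 - x0) - mu *: (x2 - x1)).
  rewrite mulmxBr /e1 /e2; apply/colP => i; rewrite !mxE; ring.
have -> : gamma * ((mu + l_f + c1) / gamma * enorm (x2 - x1) +
    (mu + c1) / gamma * enorm (x1 - x0)) =
    (mu + l_f + c1) * enorm (x2 - x1) + (mu + c1) * enorm (x1 - x0).
  by field; rewrite gt_eqF.
have := fL x2 x1.
have := enormD (e2 - e1 - (grad f x2 - grad f x1)) (mu *: (x1 - x0) - mu *: (x2 - x1)).
have := enormD (e2 - e1) (- (grad f x2 - grad f x1)).
have := enormD e2 (- e1).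
have := enormD (mu *: (x1 - x0)) (- (mu *: (x2 - x1))).
rewrite !enormN !enormZ ger0_norm//; lra.
Qed.

End Iteration.

(** * Descent, vanishing increments and passage to the limit *)

Theorem theorem13 (R : realType) (n m : nat)
    (f : 'cV[R]_n -> R) (A : 'M[R]_(m, n)) (b : 'cV[R]_m)
    (lambda mu sigma_f l_f L_f gamma rho c1 c2 c3 c4 beta l_g alpha t : R)
    (eps : nat -> R)
    (x : nat -> 'cV[R]_n) (u y : nat -> 'cV[R]_m)
    (lambda_gt0 : 0 < lambda) (mu_gt0 : 0 < mu)
    (f_C2 : twice_cont_diff f)
    (f_wconvex : weakly_convex sigma_f f)
    (f_grad : grad_lipschitz l_f f)
    (f_hess : hess_lipschitz L_f f)
    (A_row_free : row_free A)
    (gamma_gt0 : 0 < gamma)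
    (gamma_def : is_lambda_min (A *m A^T) (gamma ^+ 2))
    (f_coercive : coercive f)
    (c1_gt0 : 0 < c1) (c2_gt0 : 0 < c2)
    (mu_sigma : sigma_f < mu)
    (c3_def : c3 = (mu + l_f + c1) / gamma)
    (c4_def : c4 = (mu + c1) / gamma)
    (rho_gt : Num.max (8 * (c3 ^+ 2 + c4 ^+ 2) / mu) (4 * l_f / gamma ^+ 2) < rho)
    (beta_def : beta = 4 * c4 ^+ 2 / rho)
    (eps_gt0 : forall k : nat, 0 < eps k)
    (eps_cvg0 : eps k @[k --> \oo] --> 0)
    (l_g_gt0 : 0 < l_g)
    (g_grad : forall k : nat, grad_lipschitz l_g (subpb mu rho f A b (x k) (y k)))
    (alpha_bounds : 0 < alpha < 1 / l_g)
    (t_bounds : 0 < t < 2 / l_g)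
    (xuy_iNALM : iNALM lambda mu rho sigma_f alpha t c1 c2 eps f A b x u y) :
  forall (xs : 'cV[R]_n) (us ys : 'cV[R]_m),
    cluster ((x k, u k, y k) @[k --> \oo]) (xs, us, ys) ->
    P_stationary_triplet lambda f A b xs us ys.
Proof.
move=> xs us ys /cluster_subseq[phi phi_gt xuy_cvg].
have [df dgf _] := f_C2.
have /andP[alpha0 _] := alpha_bounds.
have rho0 : 0 < rho.
  apply: le_lt_trans rho_gt; rewrite le_max; apply/orP; left.
  by apply: divr_ge0 (ltW mu_gt0); rewrite mulr_ge0// addr_ge0// sqr_ge0.
have rho_mu : 8 * (c3 ^+ 2 + c4 ^+ 2) < mu * rho.
  by move: rho_gt; rewrite gt_max ltr_pdivrMr// (mulrC mu) => /andP[].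
pose dx k := enorm (x k.+1 - x k).
pose r k : 'cV[R]_m := A *m x k + b - u k.
have ysucc k : y k.+1 = y k + rho *: r k.+1 by have [] := xuy_iNALM k.
have inex k := let: And3 h _ _ := xuy_iNALM k in inner_solve_inexact h.
have gradE k : grad (subpb mu rho f A b (x k) (y k)) (col_mx (x k.+1) (u k.+1)) =
    col_mx (grad f (x k.+1) + A^T *m y k.+1 + mu *: (x k.+1 - x k)) (- y k.+1).
  by rewrite grad_subpb// col_mxKu col_mxKd -/(r k.+1) -ysucc.
have stat k : enorm (grad f (x k.+1) + A^T *m y k.+1 + mu *: (x k.+1 - x k))
    <= c1 * dx k.
  by have [+ _ _] := inex k; rewrite /res1 /gradx gradE !col_mxKu.
have opt k z : alpha ^+ 2 / 2 * enorm (y k.+1) ^+ 2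
    + alpha * lambda * (hpos (u k.+1))%:R
    - prox_obj (alpha * lambda) (u k.+1 + alpha *: y k.+1) z <= eps k.
  have [_ _] := inex k; rewrite /res3 /gradu gradE !col_mxKd enormN scalerN.
  rewrite (_ : u k.+1 - _ = u k.+1 + alpha *: y k.+1); last by rewrite opprK.
  move=> h; apply: le_trans h; apply: lerB => //.
  by apply: envelope_h_le; rewrite mulr_ge0// ltW.
have dyle k : enorm (y k.+2 - y k.+1) <= c3 * dx k.+1 + c4 * dx k.
  rewrite c3_def c4_def.
  exact: multiplier_diff_le (ltW mu_gt0) gamma_gt0 gamma_def f_grad (stat k) (stat k.+1).
pose L k := auglag lambda rho f A b (x k) (u k) (y k).
(* The index starts at iterate 1 because [stat] says nothing about the initial point. *)
pose V k := L k.+1 + beta / 2 * dx k ^+ 2.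
have Vdec k : V k.+1 + mu / 4 * dx k.+1 ^+ 2 <= V k.
  have [_ + _] := xuy_iNALM k.+1.
  rewrite /lyapunov subrr -/(dx k.+1) -/(L k.+1).
  have -> : enorm (0 : 'cV[R]_n) = 0 by apply/eqP; rewrite enorm_eq0.
  rewrite expr0n mulr0 addr0 => dec.
  rewrite /V {1}/L (auglag_dual_step _ _ rho0 (ysucc k.+1)) beta_def.
  (* By [(a + b)^2 <= 2 a^2 + 2 b^2]; after division by [rho] the coefficient of [dx k ^+ 2] is
     exactly [beta / 2]. The coefficient of [dx k.+1 ^+ 2], together with the new [beta / 2], is at
     most [mu / 4] by [cmu], half of the proximal term. *)
  have dy2 : enorm (y k.+2 - y k.+1) ^+ 2
      <= 2 * c3 ^+ 2 * dx k.+1 ^+ 2 + 2 * c4 ^+ 2 * dx k ^+ 2.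
    have : enorm (y k.+2 - y k.+1) ^+ 2 <= (c3 * dx k.+1 + c4 * dx k) ^+ 2.
      by rewrite lerXn2r ?nnegrE ?(le_trans _ (dyle k)) ?enorm_ge0.
    have := sqr_ge0 (c3 * dx k.+1 - c4 * dx k); lra.
  have {}dy2 : enorm (y k.+2 - y k.+1) ^+ 2 / rho
      <= (2 * c3 ^+ 2 * dx k.+1 ^+ 2 + 2 * c4 ^+ 2 * dx k ^+ 2) / rho.
    by rewrite ler_pM2r ?invr_gt0.
  have cmu : 2 * (c3 ^+ 2 + c4 ^+ 2) / rho <= mu / 4.
    by rewrite ler_pdivrMr//; lra.
  have := ler_wpM2r (sqr_ge0 (dx k.+1)) cmu.
  move: dy2 dec; rewrite !mulrDl; lra.
have xuphi : (x (phi k), u (phi k)) @[k --> \oo] --> (xs, us).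
  exact: (cvg_comp _ _ xuy_cvg (@cvg_fst _ _ (nbhs (xs, us)) (nbhs ys) _)).
have yphi : y (phi k) @[k --> \oo] --> ys.
  exact: (cvg_comp _ _ xuy_cvg (@cvg_snd _ _ (nbhs (xs, us)) (nbhs ys) _)).
have xphi : x (phi k) @[k --> \oo] --> xs.
  exact: (cvg_comp _ _ xuphi (@cvg_fst _ _ (nbhs xs) (nbhs us) _)).
have uphi : u (phi k) @[k --> \oo] --> us.
  exact: (cvg_comp _ _ xuphi (@cvg_snd _ _ (nbhs xs) (nbhs us) _)).
have rphi : r (phi k) @[k --> \oo] --> A *m xs + b - us.
  by apply: cvgB => //; apply: cvgD; [exact: cvg_mulmx|exact: cvg_cst].
(* The inner solve that produces iterate [phi k] has index [psi k]. *)
pose psi k := (phi k).-1.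
have psiS k : (psi k).+1 = phi k by rewrite prednK// (leq_ltn_trans _ (phi_gt k)).
have psi_ge k : (k <= psi k)%N by rewrite -ltnS psiS.
have dx0 : dx k @[k --> \oo] --> 0.
  rewrite -(cvg_shiftS dx).
  (* The part of [L] without [hpos] is continuous, so it converges along [phi] and bounds [L] from
     below. *)
  pose S k := aug_smooth rho f A b (x k) (u k) (y k).
  have Sphi : S (phi k) @[k --> \oo] --> aug_smooth rho f A b xs us ys.
    apply: cvgD; first apply: cvgD.
    - exact: cvg_comp xphi (differentiable_continuous (df xs)).
    - exact: cvg_dotp.
    - apply: cvgM; first exact: cvg_cst.
      rewrite enorm_sqr; under eq_cvg do rewrite enorm_sqr.
      exact: cvg_dotp.
  apply: (@descent_cvg0 _ V _ (mu / 4) (aug_smooth rho f A b xs us ys - 1)) => //.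
    by rewrite divr_gt0.
  move=> N.
  have : \forall k \near \oo, aug_smooth rho f A b xs us ys - 1 < S (phi k).
    by apply: (cvgr_gt _ Sphi); rewrite ltrBlDr ltrDl.
  move=> [K _ KP].
  (* [V (psi k)] contains [L (phi k)], which is at least [S (phi k)]. *)
  exists (psi (maxn N K)); first exact: leq_trans (leq_maxl N K) (psi_ge _).
  apply: le_trans (ltW (KP (maxn N K) (leq_maxr _ _))) _.
  rewrite /V psiS /L /auglag -/(S _) -addrA lerDl addr_ge0//.
    by rewrite mulr_ge0 ?ler0n// ltW.
  apply: mulr_ge0 (sqr_ge0 _); rewrite beta_def.
  apply: divr_ge0 => //; apply: divr_ge0 (ltW rho0).
  by apply: mulr_ge0 (sqr_ge0 _).
have dxpsi := cvg_subseq_ge psi_ge dx0.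
(* The constraint residual is the multiplier increment divided by [rho], controlled by [dyle]. *)
have r0 : enorm (r k.+2) @[k --> \oo] --> 0.
  have bd : rho^-1 * (c3 * dx k.+1 + c4 * dx k) @[k --> \oo] --> 0.
    have dx1 : dx k.+1 @[k --> \oo] --> 0 by rewrite (cvg_shiftS dx).
    have cst a : (fun _ : nat => a : R) @ \oo --> a by exact: cvg_cst.
    have := cvgM (cst rho^-1) (cvgD (cvgM (cst c3) dx1) (cvgM (cst c4) dx0)).
    by rewrite !mulr0 addr0 mulr0; exact.
  apply: (squeeze_cvgr _ (cvg_cst (0 : R)) bd).
  apply: nearW => k; rewrite enorm_ge0 /= ler_pdivlMl//.
  apply: le_trans (dyle k).
  have -> : y k.+2 - y k.+1 = rho *: r k.+2 by rewrite (ysucc k.+1) addrC addKr.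
  by rewrite enormZ gtr0_norm.
(* The inner solver's step size is independent of [k], so it also serves in the limit. *)
exists alpha; split => //.
- have gphi : grad f (x (phi k)) + A^T *m y (phi k) @[k --> \oo] --> grad f xs + A^T *m ys.
    apply: cvgD; last exact: cvg_mulmx.
    exact: cvg_comp xphi (differentiable_continuous (dgf xs)).
  have gphi0 : enorm (grad f (x (phi k)) + A^T *m y (phi k)) @[k --> \oo] --> 0.
    have bd : (c1 + mu) * dx (psi k) @[k --> \oo] --> 0.
      by rewrite -(mulr0 (c1 + mu)); apply: cvgM dxpsi; exact: cvg_cst.
    apply: (squeeze_cvgr _ (cvg_cst (0 : R)) bd).
    apply: nearW => k; rewrite enorm_ge0 /= -psiS.
    have := enormD (grad f (x (psi k).+1) + A^T *m y (psi k).+1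
      + mu *: (x (psi k).+1 - x (psi k))) (- (mu *: (x (psi k).+1 - x (psi k)))).
    rewrite addrK enormN enormZ gtr0_norm// -/(dx _); have := stat (psi k); lra.
  apply/eqP; rewrite -enorm_eq0; apply/eqP.
  exact: cvg_unique (cvg_enorm gphi) gphi0.
- apply: (prox_h_limit (e := fun k => eps (psi k)) _ uphi yphi).
  + by rewrite mulr_ge0// ltW.
  + exact: cvg_subseq_ge eps_cvg0.
  + by move=> z k; rewrite -psiS.
- apply/eqP; rewrite -enorm_eq0; apply/eqP.
  have r0' : enorm (r k) @[k --> \oo] --> 0.
    by rewrite -(cvg_shiftS (fun k => enorm (r k))) -(cvg_shiftS (fun k => enorm (r k.+1))).
  exact: cvg_unique (cvg_enorm rphi) (cvg_subseq_ge (fun k => ltnW (phi_gt k)) r0').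
Qed.
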